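(* Let $A\in\mathbb{C}_{n,m}$ and $D, E\in \mathbb{C}_{m,n}$ be such that $A^{\parallel (D,E)}$ exists, and consider sequences $(A_k)_{k\in\mathbb{N}} \subset \mathbb{C}_{n,m}$ and $(D_k)_{k\in\mathbb{N}}, (E_k)_{k\in\mathbb{N}} \subset \mathbb{C}_{m,n}$ such that $A_k^{\parallel (D_k, E_k)}$ exists for each $k\in\mathbb{N}$. Let $D', E' \in \mathbb{C}_{n, m}$ and $(D'_k)_{k\in\mathbb{N}}, (E'_k)_{k\in\mathbb{N}}\subset \mathbb{C}_{n,m}$ be such that $D=DD'D$, $E=EE'E$, $D_k=D_kD'_k D_k$ and $E_k=E_kE'_kE_k$ for each $k\in\mathbb{N}$. Suppose that $(A_k)_{k\in\mathbb{N}}$, $(D_kD'_k)_{k\in\mathbb{N}}$ and $(E'_kE_k)_{k\in\mathbb{N}}$ converge to $A$, $DD'$ and $E'E$, respectively. Then the following statements are equivalent. (i) $(A_k^{\parallel (D_k, E_k)})_{k\in\mathbb{N}}$ converges to $A^{\parallel (D, E)}$. (ii) The sequence $(A_k^{\parallel (D_k, E_k)})_{k\in\mathbb{N}}\subset \mathbb{C}_{m,n}$ is bounded.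
   Context: $\mathbb{C}_{m,n}$ is the set of $m\times n$ complex matrices ($m,n\in\mathbb{N}$), with its usual (norm) topology. For a matrix $M\in\mathbb{C}_{p,q}$, $\mathcal{R}(M)$ is its column space and $\mathcal{N}(M)=\{\mathbf{x}\in\mathbb{C}^q: M\mathbf{x}=\mathbf{0}\}$ its null space. For $A \in \mathbb{C}_{n,m}$ and $D,E \in \mathbb{C}_{m,n}$, $A$ is $(D,E)$-invertible if there exists $X\in\mathbb{C}_{m,n}$ such that $XAD=D$, $EAX=E$, $\mathcal{R}(X)\subseteq\mathcal{R}(D)$ and $\mathcal{N}(E)\subseteq\mathcal{N}(X)$. Such an $X$ is unique if it exists; it is called the $(D,E)$-inverse of $A$ and denoted $A^{\parallel (D,E)}$. *)

(* Defs.v *)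
From HB Require Import structures.
From mathcomp Require Export all_boot all_order all_algebra.
From mathcomp Require Export all_classical all_reals all_analysis.
From mathcomp Require Export complex.

Set Implicit Arguments.
Unset Strict Implicit.
Unset Printing Implicit Defensive.

Export numFieldNormedType.Exports.

Import GRing.Theory.
Local Open Scope classical_set_scope.
Local Open Scope ring_scope.

(* The topology and norm of the complex numbers, given by the modulus; the
   library attaches them to abstract number fields and to R[i]^o, not to R[i]. *)
HB.instance Definition _ (R : realType) := NormedModule.copy R[i] R[i]^o.

Section Spaces.
Context {F : fieldType} {p q : nat}.
Implicit Type M : 'M[F]_(p, q).

(* mathcomp's own row spaces and kernels are those of M acting on row vectors;
   these are the spaces of M acting on column vectors. *)
Definition colspace M : set 'cV[F]_p := range (fun x : 'cV[F]_q => M *m x).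

Definition nullspace M : set 'cV[F]_q := [set x | M *m x = 0].

End Spaces.

Section DEInverse.
Context {F : fieldType} {m n : nat}.
Implicit Types (A : 'M[F]_(n, m)) (D E X Y : 'M[F]_(m, n)).

Definition is_DEinverse A D E X : Prop :=
  [/\ X *m A *m D = D,
      E *m A *m X = E,
      colspace X `<=` colspace D &
      nullspace E `<=` nullspace X].

Definition DEinvertible A D E : Prop := exists X, is_DEinverse A D E X.

(* The default value 0 is taken only when A is not (D, E)-invertible. *)
Definition DEinverse A D E : 'M[F]_(m, n) := xget 0 [set X | is_DEinverse A D E X].

Lemma is_DEinverse_uniq A D E X Y :
  is_DEinverse A D E X -> is_DEinverse A D E Y -> X = Y.
Proof.
move=> [_ EAX XD _] [YAD _ _ EY].
have eq_mulv p q (M N : 'M[F]_(p, q)) :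
    (forall v : 'cV_q, M *m v = N *m v) -> M = N.
  move=> MN; apply/trmx_inj/row_matrixP => j.
  by rewrite -!tr_col !colE MN.
have YAX_X : Y *m A *m X = X.
  apply: eq_mulv => v; have [u _ Du] : colspace D (X *m v) by apply: XD; exists v.
  by rewrite -mulmxA -Du mulmxA YAD.
rewrite -YAX_X; apply: eq_mulv => v.
have /EY : nullspace E (A *m X *m v - v).
  by rewrite /nullspace /= mulmxBr !mulmxA EAX subrr.
by rewrite /nullspace /= mulmxBr !mulmxA => /eqP; rewrite subr_eq0 => /eqP.
Qed.

Lemma DEinverseP A D E :
  DEinvertible A D E -> is_DEinverse A D E (DEinverse A D E).
Proof. by move=> [X AX]; apply: (xgetPex 0 (P := is_DEinverse A D E)); exists X. Qed.

End DEInverse.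

(* Main.v *)
Require Import Defs.

Import Order.TTheory GRing.Theory Num.Theory.

Local Open Scope classical_set_scope.
Local Open Scope ring_scope.

(** Write X and X_k for the two kinds of inverses, P = D D', Q = E' E for the
    idempotents attached to D and E, and P_k, Q_k for those of D_k and E_k.
    The defining conditions of X say that X is fixed by P on the left and by Q
    on the right, and that X A and A X act as identities against P and Q:
    X A P = P and Q A X = Q; likewise for X_k.  Although X and X_k live on
    different ranges and kernels, these relations give the exact formula

      X_k - X = (1 - X A) (P_k - P) X_k + X (A - A_k) X_k
                + X (Q_k - Q) (1 - A_k X_k)

    ([DEinverse_subE]), a perturbation formula in the style of
    B^-1 - A^-1 = A^-1 (A - B) B^-1 with correction terms for the change of
    range and of kernel.  Each summand has a factor tending to 0; the remaining
    factors are bounded as soon as (X_k) is, since (A_k) converges, and then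
    X_k tends to X ([cvg0_mulmxl], [cvg0_mulmxr]).  Conversely a
    convergent sequence is bounded. *)

(** * Projectors attached to inner inverses *)

Section Projectors.
Context {F : fieldType}.

Lemma eq_col_mx {p q} (M N : 'M[F]_(p, q)) :
  (forall j, col j M = col j N) -> M = N.
Proof.
by move=> MN; apply/trmx_inj/row_matrixP => j; rewrite -!tr_col MN.
Qed.

(** [M *m M'] is idempotent with the range of [M], hence it fixes every matrix
    whose columns lie in that range.  The range thus enters formulas as a
    matrix, of which a limit can be taken. *)
Lemma mulmx_inner_colspace {p q r} (M : 'M[F]_(p, q)) (M' : 'M[F]_(q, p))
    (X : 'M[F]_(p, r)) :
  M = M *m M' *m M -> colspace X `<=` colspace M -> M *m M' *m X = X.
Proof.
move=> MM'M XM; apply: eq_col_mx => j; rewrite !colE -mulmxA.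
have [u _ <-] : colspace M (X *m delta_mx j 0).
  by apply: XM; exists (delta_mx j 0).
by rewrite mulmxA -MM'M.
Qed.

(** [1 - M' *m M] has its columns in the null space of [M], hence it is killed
    by every matrix whose null space contains that of [M]. *)
Lemma mulmx_inner_nullspace {p q r} (M : 'M[F]_(p, q)) (M' : 'M[F]_(q, p))
    (X : 'M[F]_(r, q)) :
  M = M *m M' *m M -> nullspace M `<=` nullspace X -> X *m (M' *m M) = X.
Proof.
move=> MM'M MX; apply/eqP; rewrite -subr_eq0; apply/eqP; apply: eq_col_mx => j.
rewrite !colE mul0mx mulmxBl -!mulmxA -mulmxBr; apply: MX.
by rewrite /nullspace /= mulmxBr !mulmxA -MM'M subrr.
Qed.

(** With [Pi = Di *m Di'] and [Qi = Ei' *m Ei], the rules [P2 X2 = X2],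
    [X1 A1 P1 = P1], [X1 Q1 = X1] and [Q2 A2 X2 = Q2] turn the three summands
    into [X2 - X1 A1 X2], [X1 A1 X2 - X1 A2 X2] and [X1 A2 X2 - X1], whose sum
    telescopes. *)
Lemma DEinverse_subE {m n} (A1 A2 : 'M[F]_(n, m))
    (D1 E1 D2 E2 X1 X2 : 'M[F]_(m, n)) (D1' E1' D2' E2' : 'M[F]_(n, m)) :
    E1 = E1 *m E1' *m E1 -> D2 = D2 *m D2' *m D2 ->
    is_DEinverse A1 D1 E1 X1 -> is_DEinverse A2 D2 E2 X2 ->
  X2 - X1 = (1%:M - X1 *m A1) *m (D2 *m D2' - D1 *m D1') *m X2
          + X1 *m (A1 - A2) *m X2
          + X1 *m (E2' *m E2 - E1' *m E1) *m (1%:M - A2 *m X2).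
Proof.
move=> hE1 hD2 [X1A1D1 _ _ kerX1] [_ E2A2X2 ranX2 _].
have P2X2 := mulmx_inner_colspace _ _ _ hD2 ranX2.
have X1Q1 := mulmx_inner_nullspace _ _ _ hE1 kerX1.
have X1A1P1 : X1 *m A1 *m (D1 *m D1') = D1 *m D1' by rewrite mulmxA X1A1D1.
have Q2A2X2 : E2' *m E2 *m A2 *m X2 = E2' *m E2.
  by rewrite -!mulmxA (mulmxA E2) E2A2X2.
have X1A1P2X2 := congr1 (mulmx (X1 *m A1)) P2X2.
have X1Q2A2X2 := congr1 (mulmx X1) Q2A2X2.
rewrite !(mulmxBl, mulmxBr) !mulmx1 !mul1mx.
rewrite !mulmxA in X1Q1 X1A1P1 X1A1P2X2 X1Q2A2X2 *.
rewrite X1A1P2X2 P2X2 X1Q1 X1Q2A2X2 X1A1P1.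
by rewrite !opprB [X in _ = _ + X]addrC !subrKA.
Qed.

End Projectors.

(** * Products of null and bounded families of matrices *)

Section MatrixNorm.
Context {K : numFieldType}.

Lemma ler_normmx_entry {p q} (M : 'M[K]_(p, q)) i j : `|M i j| <= `|M|.
Proof.
rewrite [leRHS]/Num.norm /= mx_normE -[leLHS]nngE num_le.
exact: (le_bigmax _ (fun ij : 'I_p * 'I_q => `|M ij.1 ij.2|%:nng) (i, j)).
Qed.

Lemma normmx_le {p q} (M : 'M[K]_(p, q)) (c : K) :
  0 <= c -> (forall i j, `|M i j| <= c) -> `|M| <= c.
Proof.
move=> c0 Mc; have [M0|/mx_norm_neq0[ij Mij]] := eqVneq (mx_norm M) 0.
  by rewrite [leLHS]M0.
by rewrite [leLHS]Mij.
Qed.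

(** The maximum norm is submultiplicative up to the inner dimension. *)
Lemma ler_normmxM {p q r} (M : 'M[K]_(p, q)) (N : 'M[K]_(q, r)) :
  `|M *m N| <= (`|M| * `|N|) *+ q.
Proof.
apply: normmx_le => [|i j]; first by rewrite mulrn_wge0 ?mulr_ge0.
rewrite mxE (le_trans (ler_norm_sum _ _ _))//.
have -> : (`|M| * `|N|) *+ q = \sum_(k < q) `|M| * `|N|.
  by rewrite sumr_const card_ord.
by apply: ler_sum => k _; rewrite normrM ler_pM ?ler_normmx_entry.
Qed.

Context {T : Type} {F : set_system T} {FF : Filter F}.

(** Absorbs the dimension factor of [ler_normmxM]; as its hypothesis concerns
    norms alone, it serves for a null factor on either side of a product. *)
Lemma cvg0_norm_leM {V W Z : pseudoMetricNormedZmodType K}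
    (f : T -> V) (g : T -> W) (h : T -> Z) (k : nat) :
    (forall x, `|h x| <= (`|f x| * `|g x|) *+ k) ->
  f x @[x --> F] --> 0 -> bounded_near g F -> h x @[x --> F] --> 0.
Proof.
move=> hfg f0 /ex_strict_bound_gt0[c c0 gc]; apply/cvgr0Pnorm_le => e e0.
(* The successor keeps the divisor positive when [k] is 0, which happens for
   matrices with an empty inner dimension. *)
have ck0 : 0 < c *+ k.+1 by rewrite pmulrn_lgt0.
move/cvgr0Pnorm_le: f0 => /(_ _ (divr_gt0 e0 ck0)).
apply: filterS2 gc => x /ltW gx fx.
rewrite (le_trans (hfg x))// -mulrnAr -[leRHS](divfK (lt0r_neq0 ck0)).
rewrite ler_pM// ?mulrn_wge0// (@le_trans _ _ (c *+ k)) ?lerMn2r ?gx ?orbT//.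
by rewrite ler_wpMn2l// ltW.
Qed.

Lemma cvg0_mulmxr {p q r} (f : T -> 'M[K]_(p, q)) (g : T -> 'M[K]_(q, r)) :
  f x @[x --> F] --> (0 : 'M[K]_(p, q)) -> bounded_near g F ->
  f x *m g x @[x --> F] --> (0 : 'M[K]_(p, r)).
Proof. by apply: cvg0_norm_leM => x; exact: ler_normmxM. Qed.

Lemma cvg0_mulmxl {p q r} (f : T -> 'M[K]_(p, q)) (g : T -> 'M[K]_(q, r)) :
  bounded_near f F -> g x @[x --> F] --> (0 : 'M[K]_(q, r)) ->
  f x *m g x @[x --> F] --> (0 : 'M[K]_(p, r)).
Proof.
move=> bf g0; apply: cvg0_norm_leM g0 bf => x; rewrite mulrC.
exact: ler_normmxM.
Qed.

End MatrixNorm.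

(** * The perturbation argument *)

(** Stated over any normed field: [DEinverse_subE] is purely algebraic, and the
    limits use only the maximum norm of matrices. *)
Lemma cvg_DEinverseP (K : numFieldType) (m n : nat)
  (A : 'M[K]_(n, m)) (D E : 'M[K]_(m, n))
  (A_ : nat -> 'M[K]_(n, m)) (D_ E_ : nat -> 'M[K]_(m, n))
  (D' E' : 'M[K]_(n, m)) (D'_ E'_ : nat -> 'M[K]_(n, m))
  (inv : DEinvertible A D E)
  (inv_ : forall k : nat, DEinvertible (A_ k) (D_ k) (E_ k))
  (hE : E = E *m E' *m E)
  (hD_ : forall k : nat, D_ k = D_ k *m D'_ k *m D_ k)
  (cvgA : A_ k @[k --> \oo] --> A)
  (cvgDD' : D_ k *m D'_ k @[k --> \oo] --> D *m D')
  (cvgE'E : E'_ k *m E_ k @[k --> \oo] --> E' *m E) :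
  (DEinverse (A_ k) (D_ k) (E_ k) @[k --> \oo] --> DEinverse A D E)
  <->
  bounded_fun (fun k : nat => DEinverse (A_ k) (D_ k) (E_ k)).
Proof.
set X := DEinverse A D E; set X_ := fun k => DEinverse (A_ k) (D_ k) (E_ k).
split=> [cvgX|bndX]; first exact: cvg_seq_bounded (cvgP _ cvgX).
have bndX_ : bounded_near X_ \oo.
  by apply: filterS bndX => c Xc; apply: filterE => k; exact: Xc.
have cvgA0 : A - A_ k @[k --> \oo] --> (0 : 'M[K]_(n, m)).
  by rewrite -(subrr A); apply: cvgB => //; exact: cvg_cst.
have cvgP0 : D_ k *m D'_ k - D *m D' @[k --> \oo] --> (0 : 'M[K]_m).
  by apply/subr_cvg0.
have cvgQ0 : E'_ k *m E_ k - E' *m E @[k --> \oo] --> (0 : 'M[K]_n).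
  by apply/subr_cvg0.
apply/subr_cvg0.
(* The last product of [DEinverse_subE] is expanded so that only the bounds on
   [A_] and [X_] are needed, not one on [1 - A_ k *m X_ k]. *)
have XE k : X_ k - X = (1%:M - X *m A) *m (D_ k *m D'_ k - D *m D') *m X_ k
     + X *m (A - A_ k) *m X_ k
     + (X *m (E'_ k *m E_ k - E' *m E)
        - X *m (E'_ k *m E_ k - E' *m E) *m A_ k *m X_ k).
  rewrite (DEinverse_subE _ _ _ _ _ _ _ _ D' _ _ (E'_ k) hE (hD_ k)
    (DEinverseP inv) (DEinverseP (inv_ k))).
  by rewrite [X in _ + X = _]mulmxBr mulmx1 (mulmxA (_ *m (_ - _))).
rewrite (eq_cvg _ _ XE).
have cvg0_cstM p (C : 'M[K]_(m, p)) (f : nat -> 'M[K]_(p, n)) :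
    f k @[k --> \oo] --> (0 : 'M[K]_(p, n)) ->
  C *m f k @[k --> \oo] --> (0 : 'M[K]_(m, n)).
  apply: cvg0_mulmxl; exact: (cvg_bounded _ C (cvg_cst C)).
have cvgXQ0 := cvg0_cstM _ X _ cvgQ0.
have cvgP0X : (1%:M - X *m A) *m (D_ k *m D'_ k - D *m D') *m X_ k @[k --> \oo]
    --> (0 : 'M[K]_(m, n)).
  by under eq_cvg do rewrite -mulmxA; apply/cvg0_cstM/cvg0_mulmxr.
have cvgA0X : X *m (A - A_ k) *m X_ k @[k --> \oo] --> (0 : 'M[K]_(m, n)).
  by under eq_cvg do rewrite -mulmxA; apply/cvg0_cstM/cvg0_mulmxr.
have cvgQ0X : X *m (E'_ k *m E_ k - E' *m E) *m A_ k *m X_ k @[k --> \oo]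
    --> (0 : 'M[K]_(m, n)).
  by apply: cvg0_mulmxr bndX_; apply: cvg0_mulmxr cvgXQ0 (cvg_bounded _ A cvgA).
have -> : (0 : 'M[K]_(m, n)) = 0 + 0 + (0 - 0) by rewrite subrr !addr0.
exact: cvgD (cvgD cvgP0X cvgA0X) (cvgB cvgXQ0 cvgQ0X).
Qed.

Theorem theorem8p2 (R : realType) (m n : nat)
  (A : 'M[R[i]]_(n, m)) (D E : 'M[R[i]]_(m, n))
  (A_ : nat -> 'M[R[i]]_(n, m)) (D_ E_ : nat -> 'M[R[i]]_(m, n))
  (D' E' : 'M[R[i]]_(n, m)) (D'_ E'_ : nat -> 'M[R[i]]_(n, m))
  (inv : DEinvertible A D E)
  (inv_ : forall k : nat, DEinvertible (A_ k) (D_ k) (E_ k))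
  (hD : D = D *m D' *m D)
  (hE : E = E *m E' *m E)
  (hD_ : forall k : nat, D_ k = D_ k *m D'_ k *m D_ k)
  (hE_ : forall k : nat, E_ k = E_ k *m E'_ k *m E_ k)
  (cvgA : A_ k @[k --> \oo] --> A)
  (cvgDD' : D_ k *m D'_ k @[k --> \oo] --> D *m D')
  (cvgE'E : E'_ k *m E_ k @[k --> \oo] --> E' *m E) :
  (DEinverse (A_ k) (D_ k) (E_ k) @[k --> \oo] --> DEinverse A D E)
  <->
  bounded_fun (fun k : nat => DEinverse (A_ k) (D_ k) (E_ k)).
Proof. exact: cvg_DEinverseP hE hD_ cvgA cvgDD' cvgE'E. Qed.
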